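(* Let $\lambda\in\mathbf{k}$ with $\lambda\neq 0$. Let $R$ be an associative $\mathbf{k}$-algebra, $P:R\to R$ a $\mathbf{k}$-linear map, $M$ a finite dimensional (left) $R$-module and $p:M\to M$ a $\mathbf{k}$-linear map. Then $(R,P)$ is a Rota-Baxter algebra of weight $\lambda$ and $(M,p)$ is an $(R,P)$-module (of weight $\lambda$) if and only if $(R,\lambda^{-1}P)$ is a Rota-Baxter algebra of weight $1$ and $(M,\lambda^{-1}p)$ is an $(R,\lambda^{-1}P)$-module (of weight $1$).
   Context: $\mathbf{k}$ is an algebraically closed field of characteristic zero. A Rota-Baxter algebra of weight $\lambda\in\mathbf{k}$ is a pair $(R,P)$ with $R$ an associative $\mathbf{k}$-algebra and $P:R\to R$ a $\mathbf{k}$-linear map such that $P(r)P(s)=P(P(r)s)+P(rP(s))+\lambda P(rs)$ for all $r,s\in R$. An $(R,P)$-module (of weight $\lambda$) is a pair $(M,p)$ with $M$ a left $R$-module and $p:M\to M$ a $\mathbf{k}$-linear map such that $P(r)p(m)=p(P(r)m)+p(rp(m))+\lambda p(rm)$ for all $r\in R$, $m\in M$. All modules are assumed finite dimensional over $\mathbf{k}$. *)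

(* Defs.v *)
From HB Require Import structures.
From mathcomp Require Import all_boot all_order all_algebra.

Set Implicit Arguments.
Unset Strict Implicit.
Unset Printing Implicit Defensive.

Import GRing.Theory.
Local Open Scope ring_scope.

(* An associative k-algebra is a k-vector space R with an associative bilinear
   product mul.  MathComp's algType is not used because it requires R to be
   unital and nonzero; unital algebras, with their unital modules, are
   particular cases of the setting below. *)

Definition left_module_action (k : fieldType) (R M : lmodType k)
    (mul : {bilinear R -> R -> R}) (act : {bilinear R -> M -> M}) : Prop :=
  forall (r s : R) (m : M), act (mul r s) m = act r (act s m).

Definition rota_baxter_algebra (k : fieldType) (R : lmodType k)
    (mul : {bilinear R -> R -> R}) (w : k) (P : {linear R -> R}) : Prop :=
  forall r s : R,
    mul (P r) (P s) = P (mul (P r) s) + P (mul r (P s)) + w *: P (mul r s).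

Definition rota_baxter_module (k : fieldType) (R M : lmodType k)
    (act : {bilinear R -> M -> M}) (w : k)
    (P : {linear R -> R}) (p : {linear M -> M}) : Prop :=
  forall (r : R) (m : M),
    act (P r) (p m) = p (act (P r) m) + p (act r (p m)) + w *: p (act r m).

(* Main.v *)
Require Import Defs.
From HB Require Import structures.
From mathcomp Require Import all_boot all_order all_algebra.
Import GRing.Theory.
Local Open Scope ring_scope.

(** The identity is homogeneous of degree two: two terms compose operators, the left side multiplies
    their values, and the last term has one operator and the weight. Scaling operators and weight by
    a nonzero [a] is thus reversible; [a = lam^-1] normalizes the weight to 1. *)

(* Every term of the Rota-Baxter identity is multiplied by [a ^+ 2]. *)
Lemma rota_baxter_module_scale (k : fieldType) (R M : lmodType k)
    (act : {bilinear R -> M -> M}) (w a : k)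
    (P : {linear R -> R}) (p : {linear M -> M}) :
  a != 0 ->
  rota_baxter_module act w P p <->
  rota_baxter_module act (a * w) (a \*: P) (a \*: p).
Proof.
move=> a_neq0.
have scaleE r m :
    (act ((a \*: P) r) ((a \*: p) m) =
       (a \*: p) (act ((a \*: P) r) m) + (a \*: p) (act r ((a \*: p) m))
       + (a * w) *: (a \*: p) (act r m)) <->
    (a * a) *: act (P r) (p m) =
      (a * a) *: (p (act (P r) m) + p (act r (p m)) + w *: p (act r m)).
  by rewrite /= !(linearZl_LR, linearZr_LR) /= !linearZ /= !scalerDr !scalerA mulrA.
split=> RB r m; first by apply/scaleE; rewrite RB.
(* Conversely, the common factor [a * a] is nonzero and cancels. *)
by apply: (scalerI (mulf_neq0 a_neq0 a_neq0)); apply/scaleE/RB.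
Qed.

(* A Rota-Baxter algebra is a Rota-Baxter module over itself, by conversion. *)
Theorem proposition2p3
    (k : closedFieldType) (k_char0 : [pchar k] =i pred0)
    (lam : k) (lam_neq0 : lam != 0)
    (R : lmodType k) (mul : {bilinear R -> R -> R}) (mulA : associative mul)
    (P : {linear R -> R})
    (M : vectType k) (act : {bilinear R -> M -> M})
    (actA : left_module_action mul act)
    (p : {linear M -> M}) :
  (rota_baxter_algebra mul lam P /\ rota_baxter_module act lam P p)
  <->
  (rota_baxter_algebra mul 1 (lam^-1 \*: P) /\
   rota_baxter_module act 1 (lam^-1 \*: P) (lam^-1 \*: p)).
Proof.
have lamV_neq0 : lam^-1 != 0 by rewrite invr_eq0.
have algP := rota_baxter_module_scale _ _ _ mul lam _ P P lamV_neq0.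
have modP := rota_baxter_module_scale _ _ _ act lam _ P p lamV_neq0.
(* The rescaled weight [lam^-1 * lam] becomes 1 in both equivalences. *)
rewrite mulVf // in algP modP.
by split=> -[/algP RP /modP Mp].
Qed.
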